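(* Let $A$ be an integral domain whose fraction field $\mathcal{K}(A)$ is formally real, and let $I$ be an ideal of $A$. Then $$\mathcal{I}(\mathcal{Z}^c(I))=\mathcal{I}(\mathcal{Z}^{pc}(I))=\sqrt[C]{I}.$$
   Context: All rings are commutative and contain $\mathbb{Q}$. A field is formally real if $-1$ is not a sum of squares. $\sum\mathcal{K}(A)^2$ is the set of sums of squares of $\mathcal{K}(A)$ and $\mathcal{C}=A\cap\sum\mathcal{K}(A)^2$. The central radical of $I$ is $\sqrt[C]{I}=\{a\in A\mid \exists m\in\mathbb{N},\ \exists b\in\mathcal{C},\ a^{2m}+b\in I\}$. A cone of a ring $B$ is a subset $P\subset B$ with $P+P\subset P$, $P\cdot P\subset P$ and $b^2\in P$ for all $b\in B$; it is proper if $-1\notin P$. An ordering of $B$ is a proper cone $P$ such that $ab\in P$ implies $a\in P$ or $-b\in P$; $\operatorname{Spec}_rB$ is the set of orderings of $B$. For $\alpha\in\operatorname{Spec}_rA$, write $P_\alpha$ for the corresponding cone and $\operatorname{supp}(\alpha)=P_\alpha\cap -P_\alpha$; $a(\alpha)>0$ means $a\in P_\alpha\setminus\operatorname{supp}(\alpha)$. $\operatorname{Spec}_rA$ has the topology generated by the sets $\{\alpha\mid f_1(\alpha)>0,\ldots,f_k(\alpha)>0\}$. The map $Q\mapsto Q\cap A$ identifies $\operatorname{Spec}_r\mathcal{K}(A)$ with the set of orderings of $A$ with support $(0)$; $\operatorname{Spec}_cA:=\overline{\operatorname{Spec}_r\mathcal{K}(A)}$ (closure in $\operatorname{Spec}_rA$).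 $\operatorname{Spec}_{pc}A=\{\alpha\in\operatorname{Spec}_rA\mid\mathcal{C}\subset P_\alpha\}$. For an ideal $I$, $\mathcal{Z}^r(I)=\{\alpha\in\operatorname{Spec}_rA\mid I\subset\operatorname{supp}(\alpha)\}$, $\mathcal{Z}^c(I)=\mathcal{Z}^r(I)\cap\operatorname{Spec}_cA$, $\mathcal{Z}^{pc}(I)=\mathcal{Z}^r(I)\cap\operatorname{Spec}_{pc}A$. For $W\subset\operatorname{Spec}_rA$, $\mathcal{I}(W)=\{f\in A\mid f\in\operatorname{supp}(\alpha)\text{ for all }\alpha\in W\}$. *)

(* Defs.v *)
From HB Require Import structures.
From mathcomp Require Import all_boot all_order all_algebra.
From mathcomp Require Import boolp classical_sets topology_structure.

Set Implicit Arguments.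
Unset Strict Implicit.
Unset Printing Implicit Defensive.

Import GRing.Theory.
Local Open Scope classical_set_scope.
Local Open Scope ring_scope.

(* The unit ideal is allowed, unlike in MathComp's [idealr]. *)
Definition is_ideal (B : comNzRingType) (I : set B) : Prop :=
  [/\ I 0, (forall x y, I x -> I y -> I (x + y)) & (forall a x, I x -> I (a * x))].

Definition sums_of_squares (B : comNzRingType) : set B :=
  [set x | exists s : seq B, x = \sum_(y <- s) y ^+ 2].

Definition formally_real (F : fieldType) : Prop := ~ sums_of_squares (-1 : F).

Section Orderings.
Variable B : comNzRingType.

Definition is_cone (P : set B) : Prop :=
  [/\ (forall x y, P x -> P y -> P (x + y)),
      (forall x y, P x -> P y -> P (x * y)) & (forall b, P (b ^+ 2))].

Definition is_proper_cone (P : set B) : Prop := is_cone P /\ ~ P (-1).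

Definition is_ordering (P : set B) : Prop :=
  is_proper_cone P /\ (forall a b, P (a * b) -> P a \/ P (- b)).

Record spec_r := SpecR { cone : set B; coneP : is_ordering cone }.

Definition supp (alpha : spec_r) : set B := cone alpha `&` [set a | cone alpha (- a)].

Definition pos (a : B) (alpha : spec_r) : Prop := (cone alpha `\` supp alpha) a.

Definition spec_r_open (fs : seq B) : set spec_r :=
  [set alpha | forall f, f \in fs -> pos f alpha].

HB.instance Definition _ := gen_eqMixin spec_r.
HB.instance Definition _ := gen_choiceMixin spec_r.
HB.instance Definition _ :=
  @isSubBaseTopological.Build spec_r (set spec_r) (range spec_r_open) idfun.

Definition zeros_r (I : set B) : set spec_r := [set alpha | I `<=` supp alpha].

Definition vanishing_ideal (W : set spec_r) : set B :=
  [set f | forall alpha, W alpha -> supp alpha f].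

End Orderings.

Section Central.
Variable A : idomainType.
Local Notation K := {fraction A}.

Lemma contract_ordering (Q : spec_r K) :
  is_ordering (@FracField.tofrac A @^-1` cone Q).
Proof.
case: Q => Q [[[QD QM Qsq] Qproper] Qprime] /=.
split; [split; [split|]|] => /=.
- by move=> x y Qx Qy; rewrite /= rmorphD; apply: QD.
- by move=> x y Qx Qy; rewrite /= rmorphM; apply: QM.
- by move=> b; rewrite /= rmorphXn; apply: Qsq.
- by rewrite /= rmorphN rmorph1.
- by move=> a b; rewrite /= rmorphM rmorphN; apply: Qprime.
Qed.

Definition contract (Q : spec_r K) : spec_r A := SpecR (contract_ordering Q).

Definition spec_c : set (spec_r A) := closure (range contract).

Definition fraction_sos : set A := @FracField.tofrac A @^-1` @sums_of_squares K.

Definition spec_pc : set (spec_r A) := [set alpha | fraction_sos `<=` cone alpha].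

Definition zeros_c (I : set A) : set (spec_r A) := zeros_r I `&` spec_c.

Definition zeros_pc (I : set A) : set (spec_r A) := zeros_r I `&` spec_pc.

(* Letting m = 0 changes nothing for an ideal I: if 1 + b is in I,
   then so is a ^+ 2 + a ^+ 2 * b. *)
Definition central_radical (I : set A) : set A :=
  [set a | exists m : nat, exists2 b, fraction_sos b & I (a ^+ (2 * m) + b)].

End Central.

(* Main.v *)
Require Import Defs.
From mathcomp Require Import all_boot all_order all_algebra.
From mathcomp Require Import boolp classical_sets topology_structure.
From mathcomp Require Import finmap ring.

Set Implicit Arguments.
Unset Strict Implicit.
Unset Printing Implicit Defensive.

Import GRing.Theory.
Local Open Scope classical_set_scope.
Local Open Scope ring_scope.

(** Write K for the fraction field of A and C for the sums of squares of K that
lie in A.  The equalities follow from the three inclusions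

  radical of I  <=  ideal of Z^pc(I)  <=  ideal of Z^c(I)  <=  radical of I.

The first holds because [a ^+ (2 * m) + b \in I] forces [- a ^+ (2 * m)] into
every cone that contains C and whose support contains I.  The second holds
because the central spectrum lies in the precentral one: each element of C is
nonnegative at all orderings of K, a condition that passes to the closure.

The third inclusion is the substantial one.  For [a] outside the radical it
asks for a central point [beta] whose support contains I but not [a]
([exists_central_point]).  Such a [beta] is found as a specialization of a
well-chosen ordering Q of K: an ordering of A whose cone contains [Q `&` A] is
in the closure of the point [Q `&` A] ([nbhs_generization]).  Two things are
needed.

- Q must regard the elements [z = t / a ^+ (2 * m)], with [t] in I, as
  infinitesimal, in the sense that [1 + z] is in Q.  Then the cone
  [Q `&` A + I] contains no [- a ^+ (2 * m)], and a maximal cone above it that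
  still avoids these elements is an ordering [beta]
  ([exists_ordering_avoiding]).

- Such a Q exists if [-1] is not of the form [\sum y_i ^+ 2 * (1 + z_i)].
  Suppose it is.  After adding the term [y = 1], [z = 0] and dividing by
  [\sum y_i ^+ 2], one has weights [c_i] with [\sum c_i = 1] and
  [\sum c_i * z_i = -1], so by the Cauchy-Schwarz inequality
  [1 = (\sum c_i * z_i) ^+ 2 <= \sum c_i * z_i ^+ 2 <= \sum z_i ^+ 2]
  in every ordering.  An explicit identity turns this into a certificate:
  [\sum z_i ^+ 2 - 1] is a sum of squares ([unit_cone_proper]).  Here
  [\sum z_i ^+ 2] is again some [t / a ^+ (2 * m)], and clearing the
  denominator puts [t - a ^+ (2 * m)] in C, so that [a] is in the radical of I
  ([even_fractions_sub1]). *)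

(** * Cones and the construction of orderings *)

Section Cones.
Variable B : comNzRingType.
Implicit Types (P I M : set B).

Lemma cone0 P : is_cone P -> P 0.
Proof. by case=> _ _ /(_ 0); rewrite expr0n. Qed.

Lemma cone1 P : is_cone P -> P 1.
Proof. by case=> _ _ /(_ 1); rewrite expr1n. Qed.

Lemma cone_even_exp P x m : is_cone P -> P (x ^+ (2 * m)).
Proof. by case=> _ _ Psq; rewrite mulnC exprM; apply: Psq. Qed.

Lemma idealN I x : is_ideal I -> I x -> I (- x).
Proof. by case=> _ _ IM Ix; rewrite -mulN1r; apply: (IM). Qed.

Lemma cone_sums_of_squares : is_cone (@sums_of_squares B).
Proof.
split=> [_ _ [s ->] [t ->]|_ _ [s ->] [t ->]|b].
- by exists (s ++ t); rewrite big_cat.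
- exists [seq x * y | x <- s, y <- t].
  rewrite big_distrlr big_allpairs_dep /=.
  by apply: eq_bigr => x _; apply: eq_bigr => y _; rewrite exprMn.
- by exists [:: b]; rewrite big_seq1.
Qed.

Lemma sums_of_squares_sub_cone P : is_cone P -> @sums_of_squares B `<=` P.
Proof.
move=> coneP _ [s ->]; have [PD _ Psq] := coneP.
by apply: big_rec => [|y x _ Px]; [apply: cone0 | apply: (PD)].
Qed.

Lemma cone_bigcup (F : set (set B)) P0 : F P0 ->
  total_on F subset -> (forall P, F P -> is_cone P) ->
  is_cone (\bigcup_(P in F) P).
Proof.
move=> FP0 Ftot Fcone.
have common x y : (\bigcup_(P in F) P) x -> (\bigcup_(P in F) P) y ->
    exists P, [/\ F P, P x & P y].
  move=> [X FX Xx] [Y FY Yy].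
  case: (Ftot _ _ FX FY) => sub; [exists Y | exists X]; split=> //.
    exact: sub.
  exact: sub.
split=> [x y Ux Uy|x y Ux Uy|b].
- have [P [FP Px Py]] := common x y Ux Uy.
  by exists P => //; have [PD _ _] := Fcone P FP; apply: (PD).
- have [P [FP Px Py]] := common x y Ux Uy.
  by exists P => //; have [_ PM _] := Fcone P FP; apply: (PM).
- by exists P0 => //; have [_ _ Psq] := Fcone P0 FP0; apply: Psq.
Qed.

(** The cone generated by P and x, when P is a cone: even powers of x are in P,
so terms of degree at most 1 in x suffice. *)
Definition cone_adjoin P x : set B :=
  [set z | exists p q, [/\ P p, P q & z = p + x * q]].

Lemma cone_cone_adjoin P x : is_cone P -> is_cone (cone_adjoin P x).
Proof.
move=> coneP; have [PD PM Psq] := coneP.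
split=> [_ _ [p [q [Pp Pq ->]]] [r [s [Pr Ps ->]]]
        |_ _ [p [q [Pp Pq ->]]] [r [s [Pr Ps ->]]]|b].
- by exists (p + r), (q + s); split; [exact: PD|exact: PD|by ring].
- exists (p * r + x ^+ 2 * (q * s)), (p * s + q * r).
  split; [|by apply: (PD); apply: (PM)|by ring].
  by apply: (PD); [apply: (PM)|apply: (PM); [apply: (Psq)|apply: (PM)]].
- by exists (b ^+ 2), 0; split; [exact: Psq|exact: cone0|by ring].
Qed.

Lemma sub_cone_adjoin P x : is_cone P -> P `<=` cone_adjoin P x.
Proof. by move=> /cone0 P0 p Pp; exists p, 0; split=> //; ring. Qed.

Lemma cone_adjoin_self P x : is_cone P -> cone_adjoin P x x.
Proof.
by move=> cP; exists 0, 1; split; [exact: cone0|exact: cone1|by ring].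
Qed.

(** By Zorn's lemma there is a maximal cone [P] above [P0] that meets no [- m]
with [m] in [M].  Suppose that [a * b] is in [P] but neither [a] nor [- b] is.
Adjoining either one to [P] then meets [- M]: [- m = p + a * q] and
[- n = r - b * s], with [p], [q], [r], [s] in [P].  Multiplying
[a * q = - (m + p)] by [b * s = n + r] gives [- (m * n)] in [P], a
contradiction. *)
Lemma exists_ordering_avoiding P0 M :
  is_cone P0 -> M `<=` P0 -> M 1 -> (forall x y, M x -> M y -> M (x * y)) ->
  (forall x, M x -> ~ P0 (- x)) ->
  exists alpha : spec_r B, P0 `<=` cone alpha /\
    forall x, M x -> ~ cone alpha (- x).
Proof.
move=> coneP0 MP0 M1 MM P0M.
(* The empty chain has union [set0]; stating the condition for [X `|` P0]
   instead of [X] makes it hold there too. *)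
pose good X := is_cone (X `|` P0) /\ forall x, M x -> ~ (X `|` P0) (- x).
have [X [[coneX XM] Xmax]] : exists A, good A /\ forall C, A `<` C -> ~ good C.
  apply: Zorn_bigcup => F Fgood Ftot.
  pose G := [set X `|` P0 | X in F] `|` [set P0].
  have UE : \bigcup_(X in F) X `|` P0 = \bigcup_(P in G) P.
    rewrite eqEsubset; split=> [x [[X FX Xx]|P0x]|x [_ [[X FX <-]|->]]].
    - by exists (X `|` P0); [left; exists X | left].
    - by exists P0; [right|].
    - by move=> [Xx|]; [left; exists X | right].
    - by right.
  rewrite /good UE; split.
    apply: (@cone_bigcup G P0); first by right.
      move=> _ _ [[X FX <-]|->] [[Y FY <-]|->].
      + by case: (Ftot _ _ FX FY) => sub; [left|right]; apply: setSU.
      + by right; apply: subsetUr.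
      + by left; apply: subsetUr.
      + by left.
    by move=> _ [[X FX <-]|->] //; have [] := Fgood _ FX.
  move=> x Mx [_ [[X FX <-]|->]]; last exact: P0M.
  by have [_] := Fgood _ FX; apply.
set P := X `|` P0 in coneX XM.
have P0P : P0 `<=` P by apply: subsetUr.
have [PD PM Psq] := coneX.
have adjoin_meets x : ~ P x -> exists2 m, M m & cone_adjoin P x (- m).
  move=> nPx; apply: contrapT => none.
  have P_adj : P `<=` cone_adjoin P x by apply: sub_cone_adjoin.
  apply: (Xmax (cone_adjoin P x)).
    split; first by move=> y Xy; apply: P_adj; left.
    by move=> /(_ x (cone_adjoin_self x coneX)) Xx; apply: nPx; left.
  have adjE : cone_adjoin P x `|` P0 = cone_adjoin P x.
    by apply/setUidPl; apply: subset_trans P_adj.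
  rewrite /good adjE; split; first exact: cone_cone_adjoin.
  by move=> m Mm adjm; apply: none; exists m.
have ordP : is_ordering P.
  split; first by split=> //; apply: XM.
  move=> a b Pab; apply: contrapT => /not_orP[nPa nPb].
  have [m Mm [p [q [Pp Pq mE]]]] := adjoin_meets a nPa.
  have [n Mn [r [s [Pr Ps nE]]]] := adjoin_meets (- b) nPb.
  apply: (XM (m * n)); first exact: MM.
  have -> : - (m * n) = a * b * (q * s) + (p * n + m * r + p * r).
    have aq : a * q = - m - p by rewrite mE; ring.
    have bs : b * s = n + r by rewrite -[n]opprK nE; ring.
    by transitivity ((a * q) * (b * s) + (p * n + m * r + p * r));
      [rewrite aq bs|]; ring.
  have Pm := P0P _ (MP0 _ Mm); have Pn := P0P _ (MP0 _ Mn).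
  apply: (PD); first by apply: (PM) => //; apply: (PM).
  by apply: (PD); [apply: (PD)|]; apply: (PM).
by exists (SpecR ordP); split.
Qed.

End Cones.

(** * Supports and the topology of the real spectrum *)

Section Spectrum.
Variable B : comNzRingType.
Implicit Types (alpha beta : spec_r B) (I : set B).

Lemma cone_spec alpha : is_cone (cone alpha).
Proof. by case: alpha => P [[]]. Qed.

Lemma cone_proper alpha : ~ cone alpha (- 1).
Proof. by case: alpha => P [[]]. Qed.

Lemma cone_total alpha x : cone alpha x \/ cone alpha (- x).
Proof.
have [_ _ /(_ x)] := cone_spec alpha.
by case: alpha => P [_ prime] /= Px2; apply: prime; rewrite -expr2.
Qed.

Lemma posE alpha x : pos x alpha <-> ~ cone alpha (- x).
Proof.
split=> [[ax nsx] aNx|naNx]; first exact: nsx.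
have [ax|//] := cone_total alpha x.
by split=> // -[].
Qed.

Lemma supp_prime alpha x y :
  supp alpha (x * y) -> supp alpha x \/ supp alpha y.
Proof.
case: alpha => P ordP; rewrite /supp /= => -[xy Nxy].
have [_ prime] := ordP.
have := prime x y xy; have := prime x (- y); have := prime (- x) y.
have := prime (- x) (- y).
rewrite mulrNN mulrN mulNr !opprK => /(_ xy) + /(_ Nxy) + /(_ Nxy).
tauto.
Qed.

Lemma supp_exp alpha x n : supp alpha (x ^+ n) -> supp alpha x.
Proof.
elim: n => [[_ /cone_proper]//|n IHn].
by rewrite exprS => /supp_prime[].
Qed.

Lemma supp_sub_ideal alpha I : is_ideal I -> I `<=` cone alpha ->
  I `<=` supp alpha.
Proof. by move=> idI Ia x Ix; split; apply: Ia => //; apply: idealN. Qed.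

Lemma nbhs_spec_r_open fs alpha :
  spec_r_open fs alpha -> nbhs alpha (spec_r_open fs).
Proof.
move=> afs; exists (spec_r_open fs); split=> //.
exists [set spec_r_open fs]; last by rewrite bigcup_set1.
move=> _ ->; exists [fset (spec_r_open fs : set (spec_r B))]%fset.
  by move=> W; rewrite inE => /eqP ->; apply: mem_set; exists fs.
by apply/seteqP; split=> [x /(_ (spec_r_open fs))|x xfs W /=];
  [apply; rewrite /= inE | rewrite inE => /eqP ->].
Qed.

(** A basic open set containing [beta] amounts to finitely many conditions
[- f \notin cone beta], and these survive shrinking the cone. *)
Lemma nbhs_generization alpha beta (U : set (spec_r B)) :
  cone alpha `<=` cone beta -> nbhs beta U -> U alpha.
Proof.
move=> sab [V [[D sD <-] [W DW Wb] VU]]; apply: VU; exists W; first exact: DW.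
case: (sD _ DW) => F sF eW; move: Wb; rewrite -eW.
suff: (\bigcap_(G in [set` F]) G) beta -> (\bigcap_(G in [set` F]) G) alpha.
  by [].
move=> Wb G FG; have := Wb G FG.
case: (set_mem (sF _ FG)) => fs _ <- bfs f /bfs.
by move=> /posE nb; apply/posE => /sab.
Qed.

End Spectrum.

(** For [x != 0] in the support, [- 1 = (- x) * x * x^-1 ^+ 2] would be in the
cone. *)
Lemma field_supp0 (F : fieldType) (alpha : spec_r F) x :
  supp alpha x -> x = 0.
Proof.
move=> [ax aNx]; apply: contrapT => /eqP x0; apply: (@cone_proper _ alpha).
have [_ aM sq] := cone_spec alpha.
have -> : -1 = (- x) * x * (x^-1) ^+ 2 by field.
by apply: (aM); first apply: aM.
Qed.

(** * Making the elements of a set infinitesimal *)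

Section UnitCone.
Variables (F : fieldType) (J : set F).
Hypotheses (J0 : J 0) (JD : forall y z, J y -> J z -> J (y + z)).
Hypothesis JM : forall y z, J y -> J z -> J (y * z).

(** The cone generated by [1 + J].  As J is closed under addition and
multiplication, so is [1 + J] under multiplication; this is why products of
generators do not appear. *)
Definition unit_cone : set F :=
  [set x | exists2 s : seq (F * F), (forall p, p \in s -> J p.2) &
                                    x = \sum_(p <- s) p.1 ^+ 2 * (1 + p.2)].

Lemma cone_unit_cone : is_cone unit_cone.
Proof.
split=> [_ _ [s sJ ->] [t tJ ->]|_ _ [s sJ ->] [t tJ ->]|b].
- exists (s ++ t); last by rewrite big_cat.
  by move=> p; rewrite mem_cat => /orP[/sJ|/tJ].
- exists [seq (p.1 * q.1, p.2 + q.2 + p.2 * q.2) | p <- s, q <- t].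
    move=> _ /allpairsP[[p q] [/sJ Jp /tJ Jq ->]] /=.
    by apply: (JD); [apply: (JD)|apply: (JM)].
  rewrite big_distrlr big_allpairs_dep /=.
  by apply: eq_bigr => p _; apply: eq_bigr => q _; ring.
- exists [:: (b, 0)]; last by rewrite big_seq1 /=; ring.
  by move=> p; rewrite inE => /eqP ->.
Qed.

Lemma unit_cone_add1 z : J z -> unit_cone (1 + z).
Proof.
move=> Jz; exists [:: (1, z)]; last by rewrite big_seq1 /=; ring.
by move=> p; rewrite inE => /eqP ->.
Qed.

Lemma sums_of_squares_bigsum (s : seq (F * F)) (f : F * F -> F) :
  @sums_of_squares F (\sum_(p <- s) f p ^+ 2).
Proof. by exists (map f s); rewrite big_map. Qed.

(** The difference is [\sum_(i != j) (y_i * z_j) ^+ 2]. *)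
Lemma sum_of_squares_offdiag (s : seq (F * F)) :
  @sums_of_squares F ((\sum_(p <- s) p.1 ^+ 2) * (\sum_(p <- s) p.2 ^+ 2)
                     - \sum_(p <- s) (p.1 * p.2) ^+ 2).
Proof.
have coneS := cone_sums_of_squares F; have [SD SM Ssq] := coneS.
elim: s => [|[y z] s IHs].
  by rewrite !big_nil mulr0 subr0; apply: cone0.
rewrite !big_cons /=.
set Y := \sum_(p <- s) p.1 ^+ 2 in IHs *.
set Z := \sum_(p <- s) p.2 ^+ 2 in IHs *.
set W := \sum_(p <- s) _ in IHs *.
have -> : (y ^+ 2 + Y) * (z ^+ 2 + Z) - ((y * z) ^+ 2 + W)
  = y ^+ 2 * Z + Y * z ^+ 2 + (Y * Z - W) by ring.
have SY : @sums_of_squares F Y by apply: sums_of_squares_bigsum.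
have SZ : @sums_of_squares F Z by apply: sums_of_squares_bigsum.
by apply: (SD) => //; apply: (SD); apply: (SM).
Qed.

(** The Cauchy-Schwarz step, stated contrapositively.  Let
[\sum y_i ^+ 2 * (1 + z_i) = 0], and let [Y], [Z], [W] be the sums of
[y_i ^+ 2], [z_i ^+ 2] and [(y_i * z_i) ^+ 2].  Then
[Y * (Z - 1) = (Y * Z - W) + \sum (y_i * (1 + z_i)) ^+ 2],
where [Y * Z - W] is a sum of squares.  Division by [Y] preserves sums of squares
because it is multiplication by [Y * Y^-1 ^+ 2]. *)
Lemma unit_cone_proper : formally_real F -> unit_cone (- 1) ->
  exists2 z, J z & @sums_of_squares F (z - 1).
Proof.
move=> F_real [s sJ sE].
have [SD SM Ssq] := cone_sums_of_squares F.
(* Moving [-1] to the right adds the term with [y = 1], [z = 0], by which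
   [Y] is nonzero in a formally real field. *)
pose t := (1, 0) :: s.
have tJ p : p \in t -> J p.2 by rewrite inE => /orP[/eqP ->|/sJ].
pose Y := \sum_(p <- t) p.1 ^+ 2; pose Z := \sum_(p <- t) p.2 ^+ 2.
pose W := \sum_(p <- t) (p.1 * p.2) ^+ 2.
pose V := \sum_(p <- t) (p.1 * (1 + p.2)) ^+ 2.
have t0 : \sum_(p <- t) p.1 ^+ 2 * (1 + p.2) = 0.
  by rewrite big_cons /= -sE; ring.
have VE : V = W - Y.
  have : V - W + Y = 2 * \sum_(p <- t) p.1 ^+ 2 * (1 + p.2).
    rewrite mulr_sumr -sumrB -big_split /=.
    by apply: eq_bigr => p _; ring.
  by rewrite t0 mulr0 -addrA => /eqP; rewrite addr_eq0 opprD opprK => /eqP.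
have Y0 : Y != 0.
  apply/eqP; rewrite /Y big_cons /= expr1n addrC => /eqP.
  rewrite addr_eq0 => /eqP Y0; apply: F_real; rewrite -Y0.
  exact: sums_of_squares_bigsum.
exists Z.
  rewrite /Z big_seq; apply: big_rec => // p x pt Jx.
  by apply: (JD) => //; rewrite expr2; apply: (JM); apply: tJ.
have -> : Z - 1 = (Y * Z - W + V) * Y * (Y^-1) ^+ 2 by rewrite VE; field.
apply: (SM) => //; apply: (SM); last exact: sums_of_squares_bigsum.
by apply: (SD); [apply: sum_of_squares_offdiag|apply: sums_of_squares_bigsum].
Qed.

End UnitCone.

(** * Central points away from the central radical *)

Section Central.
Variable A : idomainType.
Local Notation K := {fraction A}.
Local Notation "x %:F" := (@FracField.tofrac A x).
Implicit Types (I : set A).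

(** If some [f] in C were not in [cone alpha], then [- f] would be positive at
[alpha], hence at some ordering of K, where sums of squares are nonnegative. *)
Lemma spec_c_sub_spec_pc : @spec_c A `<=` @spec_pc A.
Proof.
move=> alpha ca f f_sos; apply: contrapT => naf.
have nb : nbhs alpha (spec_r_open [:: - f]).
  apply: nbhs_spec_r_open => g; rewrite inE => /eqP ->.
  by apply/posE; rewrite opprK.
have [_ [[Q _ <-] /(_ (- f) (mem_head _ _)) /posE]] := ca _ nb.
by rewrite opprK; apply; apply: (sums_of_squares_sub_cone (cone_spec Q)).
Qed.

Lemma central_radical_sub_vanishing I :
  central_radical I `<=` vanishing_ideal (zeros_pc I).
Proof.
move=> a [m [b b_sos Iab]] alpha [Ia pca]; apply: (@supp_exp _ _ _ (2 * m)).
have coneA := cone_spec alpha; have [AD _ _] := coneA.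
have [_ aN] := Ia _ Iab; split=> /=; first exact: cone_even_exp.
have -> : - a ^+ (2 * m) = - (a ^+ (2 * m) + b) + b by ring.
by apply: (AD) => //; apply: pca.
Qed.

Lemma fraction_sos_cone : is_cone (@fraction_sos A).
Proof.
have [SD SM Ssq] := cone_sums_of_squares K.
by split=> [x y|x y|b]; rewrite /fraction_sos /= ?rmorphD ?rmorphM ?expr2;
  [apply: (SD)|apply: (SM)|rewrite -expr2; apply: Ssq].
Qed.

(** The extension of I to the localization of A at [a]; even exponents make the
denominators squares. *)
Definition even_fractions a I : set K :=
  [set z | exists m, exists2 t, I t & z = t%:F / (a ^+ (2 * m))%:F].

Section Avoid.
Variables (I : set A) (a : A).
Hypothesis I_ideal : is_ideal I.
Hypothesis a_notin : ~ central_radical I a.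

Lemma notin_neq0 : a != 0.
Proof.
apply/eqP => a0; apply: a_notin; exists 1%N, 0.
  by apply: cone0; apply: fraction_sos_cone.
by rewrite a0 addr0 expr0n; case: I_ideal.
Qed.

Lemma powF_neq0 m : (a ^+ (2 * m))%:F != 0.
Proof. by rewrite tofrac_eq0 expf_neq0 // notin_neq0. Qed.

Lemma even_fractionsD y z : even_fractions a I y -> even_fractions a I z ->
  even_fractions a I (y + z).
Proof.
case: I_ideal => _ ID IM [m [t It ->]] [n [u Iu ->]].
exists (m + n)%N, (t * a ^+ (2 * n) + u * a ^+ (2 * m)).
  by rewrite ![_ * a ^+ _]mulrC; apply: (ID); apply: (IM).
by rewrite mulnDr exprD tofracD !tofracM addf_div ?powF_neq0.
Qed.

Lemma even_fractionsM y z : even_fractions a I y -> even_fractions a I z ->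
  even_fractions a I (y * z).
Proof.
case: I_ideal => _ ID IM [m [t It ->]] [n [u Iu ->]].
exists (m + n)%N, (t * u); first exact: IM.
by rewrite mulnDr exprD !tofracM mulf_div.
Qed.

Lemma even_fractions0 : even_fractions a I 0.
Proof. by exists 0%N, 0; [case: I_ideal|rewrite rmorph0 mul0r]. Qed.

(** Otherwise [b = t - a ^+ (2 * m)] is in C for some [t] in I, and
[a ^+ (2 * m) + b = t] shows that [a] is in the radical. *)
Lemma even_fractions_sub1 z : even_fractions a I z ->
  ~ @sums_of_squares K (z - 1).
Proof.
move=> [m [t It ->]] sos; apply: a_notin.
exists m, (t - a ^+ (2 * m)); last by rewrite addrC subrK.
have [SD SM Ssq] := cone_sums_of_squares K.
rewrite /fraction_sos /=.
have -> : (t - a ^+ (2 * m))%:F =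
    ((a ^+ m)%:F) ^+ 2 * (t%:F / (a ^+ (2 * m))%:F - 1).
  rewrite -tofracXn -exprM [(m * 2)%N]mulnC tofracB mulrBr mulr1.
  by rewrite mulrCA divff ?mulr1 ?powF_neq0.
exact: SM.
Qed.

(** [beta] extends the cone [Q `&` A + I], where Q contains [1 + z] for every
[z] in [even_fractions a I].  If that cone contained [- a ^+ (2 * m)], then
[a ^+ (2 * m) - t] would be in [- Q] for some [t] in I.  It is also in [Q],
being the product of a square and some [1 + z].  Orderings of a field have zero
support, so [a ^+ (2 * m) = t] would be in I. *)
Lemma exists_central_point : formally_real K ->
  exists beta, zeros_c I beta /\ ~ supp beta a.
Proof.
move=> K_real; pose T := unit_cone (even_fractions a I).
have coneT : is_cone T.
  by apply: cone_unit_cone;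
     [exact: even_fractions0|exact: even_fractionsD|exact: even_fractionsM].
have properT : ~ T (- 1).
  move=> /(unit_cone_proper even_fractions0 even_fractionsD even_fractionsM
             K_real)[z Jz].
  exact: even_fractions_sub1.
have [Q [TQ _]] : exists Q : spec_r K, T `<=` cone Q /\
    forall x, x = 1 -> ~ cone Q (- x).
  apply: exists_ordering_avoiding => //.
  - by move=> _ ->; apply: cone1.
  - by move=> _ _ -> ->; rewrite mulr1.
  - by move=> _ ->.
have [I0 ID IM] := I_ideal.
have [QD QM Qsq] := cone_spec (contract Q).
pose P0 := [set x | exists2 t, I t & cone (contract Q) (x + t)].
have QP0 : cone (contract Q) `<=` P0 by move=> x Qx; exists 0; rewrite ?addr0.
have coneP0 : is_cone P0.
  split=> [x y [t It xt] [u Iu yu]|x y [t It xt] [u Iu yu]|b].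
  - by exists (t + u); [apply: (ID)|rewrite addrACA; apply: (QD)].
  - exists ((y + u) * t + x * u).
      by apply: (ID); apply: (IM).
    by have := QM _ _ xt yu; congr cone; ring.
  - by apply: QP0; apply: Qsq.
have IP0 : I `<=` P0.
  move=> t It; exists (- t); first exact: idealN.
  by rewrite subrr; apply: cone0; apply: cone_spec.
have [|||x|beta [P0b bM]] := @exists_ordering_avoiding A P0
    [set x | exists m, x = a ^+ (2 * m)] coneP0.
- by move=> _ [m ->]; apply: cone_even_exp.
- by exists 0%N; rewrite expr0.
- by move=> _ _ [m ->] [n ->]; exists (m + n)%N; rewrite mulnDr exprD.
- move=> [m ->] [t It Qt]; apply: a_notin; exists m, 0.
    by apply: cone0; apply: fraction_sos_cone.
  rewrite addr0; have -> : a ^+ (2 * m) = t; last by [].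
  apply/eqP; rewrite -subr_eq0 -tofrac_eq0; apply/eqP.
  apply: (@field_supp0 _ Q); split; last first.
    by rewrite /= -rmorphN opprB addrC.
  have [_ QKM QKsq] := cone_spec Q.
  have -> : (a ^+ (2 * m) - t)%:F =
     ((a ^+ m)%:F) ^+ 2 * (1 + (- t)%:F / (a ^+ (2 * m))%:F).
    rewrite -tofracXn -exprM [(m * 2)%N]mulnC tofracB tofracN mulrDr mulr1.
    by rewrite mulrCA divff ?mulr1 ?powF_neq0.
  apply: (QKM); first exact: QKsq.
  apply: TQ; apply: unit_cone_add1; exists m, (- t) => //.
  exact: idealN.
exists beta; split; first split.
- by apply: supp_sub_ideal => // t It; apply: P0b; apply: IP0.
- move=> U bU; exists (contract Q); split; first by exists Q.
  by apply: nbhs_generization bU => x /QP0 /P0b.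
- move=> [ba bNa]; apply: (bM (a ^+ (2 * 1))); first by exists 1%N.
  have [_ bMul _] := cone_spec beta.
  by rewrite muln1 expr2 -mulrN; apply: (bMul).
Qed.

End Avoid.
End Central.

Theorem proposition5p1 (A : idomainType) (iota : {rmorphism rat -> A})
    (K_real : formally_real {fraction A}) (I : set A) (I_ideal : is_ideal I) :
  vanishing_ideal (zeros_c I) = vanishing_ideal (zeros_pc I) /\
  vanishing_ideal (zeros_pc I) = central_radical I.
Proof.
have rad_pc := @central_radical_sub_vanishing A I.
have pc_c : vanishing_ideal (zeros_pc I) `<=` vanishing_ideal (zeros_c I).
  move=> f Zf alpha [Ia ca]; apply: Zf; split=> //.
  exact: spec_c_sub_spec_pc.
have c_rad : vanishing_ideal (zeros_c I) `<=` central_radical I.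
  move=> a Za; apply: contrapT => a_notin.
  have [beta [Zb nba]] := exists_central_point I_ideal a_notin K_real.
  exact/nba/Za.
split; apply/seteqP; split=> //; first by move=> f /c_rad /rad_pc.
by move=> f /pc_c /c_rad.
Qed.
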